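(* Let $F$ be a field of characteristic $p$, where either $p = 0$ or $p > n$, and let $A = F[x_1,x_2,\ldots,x_n]/(x_1^2,x_2^2,\ldots,x_n^2)$. Let $g = (1+x_1)(1+x_2)\cdots(1+x_n) \in A$ (the sum of all square-free monomials), and let $\times g : A \to A$ be the $F$-linear map $m \mapsto gm$. Then the Weyr structure of $\times g$ (associated with its sole eigenvalue $1$) is the sequence of binomial coefficients $\binom{n}{i}$, $0 \le i \le n$, arranged in decreasing (i.e. non-increasing) order.
   Context: The Weyr structure of an endomorphism $T$ of a finite-dimensional vector space associated with an eigenvalue $\lambda$ is the sequence $(n_1,\ldots,n_r)$, where $r$ is the least positive integer with $\operatorname{rank}(T-\lambda I)^r = \operatorname{rank}(T-\lambda I)^{r+1}$ and $n_i = \operatorname{rank}(T-\lambda I)^{i-1} - \operatorname{rank}(T-\lambda I)^i$ for $i=1,\ldots,r$. It satisfies $n_1 \ge n_2 \ge \cdots \ge n_r \ge 1$. *)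

(* Defs.v *)
From HB Require Import structures.
From mathcomp Require Import all_boot all_order all_algebra all_field.
From mathcomp Require Import mpoly.

Set Implicit Arguments.
Unset Strict Implicit.
Unset Printing Implicit Defensive.

Import GRing.Theory.
Local Open Scope ring_scope.
Local Open Scope quotient_scope.

Section Weyr.
Variables (F : fieldType) (vT : vectType F).
Implicit Types (T : 'End(vT)) (a : F).

Definition lfun_iter T (k : nat) : 'End(vT) := iter k (comp_lfun T) \1%VF.

Definition eig_rank T a (k : nat) : nat :=
  \dim (limg (lfun_iter (T - a *: \1%VF) k)).

Lemma eig_rank_leq T a k : (eig_rank T a k.+1 <= eig_rank T a k)%N.
Proof.
rewrite /eig_rank; set N := T - _.
have -> : lfun_iter N k.+1 = (lfun_iter N k \o N)%VF.
  elim: k => [|k IHk]; first by rewrite /= comp_lfun1r comp_lfun1l.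
  by rewrite -comp_lfunA -IHk.
by rewrite limg_comp dimvS // limgS // subvf.
Qed.

Lemma weyr_index_exists T a :
  exists r : nat, (0 < r)%N && (eig_rank T a r == eig_rank T a r.+1).
Proof.
suff Hd d j : (eig_rank T a j <= d)%N ->
    exists r, (j <= r)%N && (eig_rank T a r == eig_rank T a r.+1).
  exact: Hd (leqnn (eig_rank T a 1)).
elim: d j => [|d IHd] j Hj; have Hr := eig_rank_leq T a j.
  by exists j; rewrite leqnn eqn_leq Hr (leq_trans Hj).
have [Heq|Hne] := eqVneq (eig_rank T a j) (eig_rank T a j.+1).
  by exists j; rewrite leqnn Heq eqxx.
have [|r /andP[Hjr Hrr]] := IHd j.+1.
  by rewrite -ltnS (leq_trans _ Hj) // ltn_neqAle eq_sym Hne.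
by exists r; rewrite (ltnW Hjr).
Qed.

Definition weyr_index T a : nat := ex_minn (weyr_index_exists T a).

(* Indices are shifted: entry i of the list is n_(i+1). The truncated
   subtraction is exact by eig_rank_leq. *)
Definition weyr_structure T a : seq nat :=
  mkseq (fun i => (eig_rank T a i - eig_rank T a i.+1)%N) (weyr_index T a).

End Weyr.

Section SquareQuotient.
Variables (F : fieldType) (n : nat).
Local Notation P := {mpoly F[n]}.
Implicit Types (p q : P) (m : 'X_{1..n}).

Definition in_sqr_ideal p : Prop :=
  exists c : 'I_n -> P, p = \sum_(i < n) c i * 'X_i ^+ 2.

Lemma in_sqr_idealD p q :
  in_sqr_ideal p -> in_sqr_ideal q -> in_sqr_ideal (p + q).
Proof.
move=> [c ->] [d ->]; exists (fun i => c i + d i).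
by rewrite -big_split; apply: eq_bigr => i _; rewrite /= mulrDl.
Qed.

Lemma in_sqr_idealM p q : in_sqr_ideal q -> in_sqr_ideal (p * q).
Proof.
move=> [c ->]; exists (fun i => p * c i).
by rewrite mulr_sumr; apply: eq_bigr => i _; rewrite mulrA.
Qed.

Lemma in_sqr_ideal0 : in_sqr_ideal 0.
Proof. by exists (fun=> 0); rewrite big1 // => i _; rewrite mul0r. Qed.

Lemma in_sqr_ideal_mcoeff p m :
  in_sqr_ideal p -> (forall i, (m i < 2)%N) -> p@_m = 0.
Proof.
move=> [c ->] Hm; rewrite raddf_sum big1 //= => i _.
apply: memN_msupp_eq0; apply/negP; rewrite mpolyXn.
move=> /msuppM_le /allpairsP[[m1 m2] /= [_ H2 Em]].
move: H2; rewrite msuppX inE => /eqP E2.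
have := Hm i; rewrite Em E2 mnmDE mulmnE mnm1E eqxx mul1n.
by rewrite ltnNge leq_addl.
Qed.

Lemma in_sqr_idealX m i : (1 < m i)%N -> in_sqr_ideal 'X_[m].
Proof.
move=> Hm; exists (fun j => if j == i then 'X_[m - U_(i) *+ 2] else 0).
rewrite (bigD1 i) //= eqxx big1 => [|j /negPf->]; last by rewrite mul0r.
rewrite addr0 mpolyXn -mpolyXD submK //.
apply/mnm_lepP => j; rewrite mulmnE mnm1E.
by case: eqP => [<-|]; rewrite ?mul1n ?mul0n.
Qed.

Lemma in_sqr_idealP p :
  reflect (in_sqr_ideal p) (all (fun m => [exists i, (1 < m i)%N]) (msupp p)).
Proof.
apply: (iffP allP) => [Hp | Hp m Hm]; last first.
  apply: contraLR Hm => /existsPn Hm; rewrite -mcoeff_eq0.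
  by apply/eqP/in_sqr_ideal_mcoeff => // i; rewrite ltnS leqNgt.
rewrite [p]mpolyE big_seq; elim/big_ind: _ => [||m /Hp/existsP[i Hi]].
- exact: in_sqr_ideal0.
- exact: in_sqr_idealD.
by rewrite -mul_mpolyC; apply: in_sqr_idealM; apply: in_sqr_idealX Hi.
Qed.

Definition sqr_ideal_dec p : decidable (in_sqr_ideal p) :=
  decP (in_sqr_idealP p).

Definition sqr_ideal : {pred P} := fun p => sqr_ideal_dec p.

Lemma sqr_idealP p : reflect (in_sqr_ideal p) (p \in sqr_ideal).
Proof. by rewrite unfold_in; apply: sumboolP. Qed.

Lemma sqr_ideal_closed : idealr_closed sqr_ideal.
Proof.
split; first exact/sqr_idealP/in_sqr_ideal0.
  apply/sqr_idealP => /in_sqr_ideal_mcoeff/(_ (fun i => _))-/(_ 0%MM).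
  by rewrite mcoeff1 eqxx => H; move/eqP: (H (fun i => ltac:(by rewrite mnm0E)));
     rewrite oner_eq0.
move=> a p q /sqr_idealP Hp /sqr_idealP Hq; apply/sqr_idealP.
by apply: in_sqr_idealD => //; apply: in_sqr_idealM.
Qed.

HB.instance Definition _ := isIdealr.Build P sqr_ideal sqr_ideal_closed.

(* The ring structure on the quotient is that of ring_quotient; only the scalar
   action and finite dimensionality are added below. *)
Definition sqr_quot := {ideal_quot sqr_ideal}.
HB.instance Definition _ := GRing.ComNzRing.on sqr_quot.

Local Notation A := sqr_quot.

Definition sqr_pi (p : P) : A := \pi p.

Lemma sqr_piP p q : sqr_pi p = sqr_pi q <-> in_sqr_ideal (p - q).
Proof.
have E : (p - q \in sqr_ideal) = (sqr_pi p == sqr_pi q).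
  exact: Quotient.idealrBE.
by split=> [/eqP | /sqr_idealP]; [rewrite -E => /sqr_idealP | rewrite E => /eqP].
Qed.

Lemma sqr_pi_surj (x : A) : exists p, x = sqr_pi p.
Proof. by exists (repr x); rewrite /sqr_pi reprK. Qed.

Fact sqr_pi_is_zmod_morphism : zmod_morphism sqr_pi.
Proof. by move=> p q; apply: (rmorphB (\pi_A)). Qed.
HB.instance Definition _ :=
  GRing.isZmodMorphism.Build P A sqr_pi sqr_pi_is_zmod_morphism.

Fact sqr_pi_is_monoid_morphism : monoid_morphism sqr_pi.
Proof.
by split=> [|p q]; [apply: (rmorph1 (\pi_A)) | apply: (rmorphM (\pi_A))].
Qed.
HB.instance Definition _ :=
  GRing.isMonoidMorphism.Build P A sqr_pi sqr_pi_is_monoid_morphism.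

Definition sqr_scale (a : F) (x : A) : A := sqr_pi a%:MP * x.

Fact sqr_scaleA a b x : sqr_scale a (sqr_scale b x) = sqr_scale (a * b) x.
Proof. by rewrite /sqr_scale mulrA -rmorphM mpolyCM. Qed.
Fact sqr_scale1 : left_id 1 sqr_scale.
Proof. by move=> x; rewrite /sqr_scale rmorph1 mul1r. Qed.
Fact sqr_scaleDr : right_distributive sqr_scale +%R.
Proof. by move=> a x y; rewrite /sqr_scale mulrDr. Qed.
Fact sqr_scaleDl x : {morph sqr_scale^~ x : a b / a + b}.
Proof. by move=> a b; rewrite /sqr_scale mpolyCD rmorphD mulrDl. Qed.
HB.instance Definition _ := GRing.Zmodule_isLmodule.Build F A
  sqr_scaleA sqr_scale1 sqr_scaleDr sqr_scaleDl.

Fact sqr_scaleAl (a : F) (x y : A) : a *: (x * y) = (a *: x) * y.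
Proof. exact: mulrA. Qed.
HB.instance Definition _ := GRing.Lmodule_isLalgebra.Build F A sqr_scaleAl.
HB.instance Definition _ := GRing.Lalgebra_isComAlgebra.Build F A.

Fact sqr_pi_is_scalable : scalable sqr_pi.
Proof. by move=> a p; rewrite -mul_mpolyC rmorphM. Qed.
HB.instance Definition _ :=
  GRing.isScalable.Build F P A *:%R sqr_pi sqr_pi_is_scalable.

(* Coordinates on the basis of squarefree monomials, indexed by subsets S of
   'I_n: mesym1 S is the exponent of \prod_(i in S) 'X_i. *)
Let d := #|{set 'I_n}|.
Let sfm (j : 'I_d) : 'X_{1..n} := mesym1 (enum_val j).

Definition sqr_coord (x : A) : 'rV[F]_d := \row_j (repr x)@_(sfm j).
Definition sqr_uncoord (v : 'rV[F]_d) : A := sqr_pi (\sum_j v 0 j *: 'X_[sfm j]).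

Lemma sfm_lt2 j i : (sfm j i < 2)%N.
Proof. by rewrite mnmE; case: (_ \in _). Qed.

Lemma sqr_coord_pi p : sqr_coord (sqr_pi p) = \row_j p@_(sfm j).
Proof.
apply/rowP => j; rewrite !mxE; apply/eqP; rewrite -subr_eq0 -mcoeffB; apply/eqP.
apply: in_sqr_ideal_mcoeff (sfm_lt2 j); apply/sqr_piP.
by rewrite /sqr_pi reprK.
Qed.

Lemma sfm_inj : injective sfm.
Proof.
move=> j k /mnmP E; apply: enum_val_inj; apply/setP => i.
by have := E i; rewrite !mnmE; do 2!case: (_ \in _).
Qed.

Lemma sfm_surj m : (forall i, (m i < 2)%N) -> exists j, m = sfm j.
Proof.
move=> Hm; exists (enum_rank [set i | m i == 1%N]); apply/mnmP => i.
by rewrite mnmE enum_rankK inE; case: (m i) (Hm i) => [|[]].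
Qed.

Lemma sfm_sum_mcoeff (v : 'rV[F]_d) j :
  (\sum_k v 0 k *: 'X_[sfm k] : P)@_(sfm j) = v 0 j.
Proof.
rewrite raddf_sum (bigD1 j) //= big1 => [|k kj].
  by rewrite mcoeffZ mcoeffX eqxx mulr1 addr0.
by rewrite mcoeffZ mcoeffX (inj_eq sfm_inj) (negPf kj) mulr0.
Qed.

Fact sqr_quot_vect_iso : Vector.axiom d A.
Proof.
exists sqr_coord => [a x y|].
  have [[p ->] [q ->]] := (sqr_pi_surj x, sqr_pi_surj y).
  rewrite -linearP !sqr_coord_pi.
  by apply/rowP => j; rewrite !mxE mcoeffD mcoeffZ.
exists sqr_uncoord => [x|v]; last first.
  by rewrite sqr_coord_pi; apply/rowP => j; rewrite mxE sfm_sum_mcoeff.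
have [p ->] := sqr_pi_surj x; apply/sqr_piP; apply/in_sqr_idealP/allP => m.
apply: contraLR => /existsPn Hm; rewrite -mcoeff_eq0 mcoeffB.
have [|j ->] := @sfm_surj m; first by move=> i; rewrite ltnS leqNgt.
by rewrite sfm_sum_mcoeff sqr_coord_pi mxE subrr.
Qed.

HB.instance Definition _ := Lmodule_hasFinDim.Build F A sqr_quot_vect_iso.
HB.instance Definition _ := Algebra_isFalgebra.Build F A.

Definition quot_var (i : 'I_n) : A := sqr_pi 'X_i.

Definition quot_g : A := \prod_(i < n) (1 + quot_var i).

Lemma quot_gE : quot_g = \sum_(S : {set 'I_n}) \prod_(i in S) quot_var i.
Proof.
rewrite /quot_g; under eq_bigr do rewrite addrC.
rewrite bigA_distr; apply: eq_bigr => S _.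
by rewrite (bigID (mem S)) /= [X in _ * X]big1 ?mulr1;
   [apply: eq_bigr => i -> | move=> i /negPf->].
Qed.

Lemma amull_sqr_quotE (x y : A) : amull x y = x * y.
Proof. exact: lfunE. Qed.

End SquareQuotient.

(* Main.v *)
(* Write A_m for the algebra on x_1, ..., x_m, g_m for the product of the
   1 + x_i with i <= m, N = g_m - 1, and r(m, k) for the rank of N^k on A_m.
   Since A_(m+1) = A_m + A_m x with x^2 = 0, and
     (g_(m+1) - 1)^(k+1) = (N + g_m x)^(k+1) = N^(k+1) + (k+1) g_m N^k x,
   where (k+1) g_m is a unit of A_m as long as k < n, elimination in the
   corresponding 2 x 2 block matrix gives
     r(m+1, k+1) = r(m, k) + r(m, k+2).
   With r(m, 0) = 2^m and N^(m+1) = 0, Pascal's rule then yields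
   r(m, k) - r(m, k+1) = C(m, floor((m-k)/2)).
   All the A_m are realised as subspaces of A_n. *)
Require Import Defs.
From HB Require Import structures.
From mathcomp Require Import all_boot all_order all_algebra all_field.
From mathcomp Require Import mpoly.
From mathcomp Require Import ring zify.

Set Implicit Arguments.
Unset Strict Implicit.
Unset Printing Implicit Defensive.

Import GRing.Theory.
Local Open Scope ring_scope.

(** * Binomial coefficients from the rank recurrence *)

Section Combinatorics.
Local Open Scope nat_scope.

(** The drop from [r m.+1 j.+1] to [r m.+1 j.+2] is the sum of the drops at [j] and [j.+2] in row
    [m], so Pascal's rule applies. At [k = 0], where no recurrence is given, [2 ^ m.+1 = 2 * 2 ^ m]
    replaces it. *)
Lemma binomial_of_recurrence (r : nat -> nat -> nat) (n : nat) :
  (forall m, m <= n -> r m 0 = 2 ^ m) ->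
  (forall m k, m < k -> r m k = 0) ->
  (forall m k, m < n -> k <= m -> r m.+1 k.+1 = r m k + r m k.+2) ->
  forall m k, m <= n -> k <= m -> r m k = r m k.+1 + 'C(m, (m - k)./2).
Proof.
move=> r0 rbig rS; elim=> [|m IHm] k lemn lekm.
  by move: lekm; rewrite leqn0 => /eqP->; rewrite r0 // rbig.
have lemn' := ltnW lemn; case: k lekm => [_|j].
  rewrite r0 // expnS -r0 // rS // mul2n -addnn -addnA; congr (_ + _).
  rewrite !subn0 (IHm 0) // subn0.
  case: m => [|m] in IHm lemn lemn' *; first by rewrite !rbig.
  rewrite (IHm 1) // -addnA; congr (_ + _).
  have -> : m.+2./2 = (m.+1 - 1)./2.+1 by lia.
  rewrite binS addnC; congr (_ + _); rewrite subn1 /=.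
  (* For even [m] the two middle coefficients of row [m.+1] are equal. *)
  have [odd_m|even_m] := boolP (odd m); first by congr 'C(_, _); lia.
  by rewrite -bin_sub; [congr 'C(_, _) |]; lia.
rewrite ltnS => lejm; rewrite rS // subSS.
(* At [j = m] the recurrence is out of range, but all three terms vanish. *)
have -> : r m.+1 j.+2 = r m j.+1 + r m j.+3.
  have [ltjm|lemj] := ltnP j m; first by rewrite rS.
  by rewrite !rbig //; lia.
rewrite (IHm j) // -!addnA; congr (_ + _).
have [lt1|le2] := ltnP m j.+2.
  rewrite !rbig ?addn0 //; try lia.
  have -> : (m - j)./2 = 0 by lia.
  by rewrite !bin0.
rewrite (IHm j.+2) //.
have -> : (m - j)./2 = (m - j.+2)./2.+1 by lia.
by rewrite binS addnCA.
Qed.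

(** [m.+1 * 'C(n, m.+1) = (n - m) * 'C(n, m)], and here [m.+1 <= n - m]. *)
Lemma leq_bin_half n m : m.*2 < n -> 'C(n, m) <= 'C(n, m.+1).
Proof.
move=> lt_mn; rewrite -(leq_pmul2l (ltn0Sn m)) mul_bin_left leq_mul2r.
by apply/orP; right; lia.
Qed.


Lemma sort_binomials n :
  mkseq (fun i => 'C(n, (n - i)./2)) n.+1 =
  sort geq [seq 'C(n, i) | i <- iota 0 n.+1].
Proof.
(* The permutation [s] of [0, n] picks, by the symmetry of the binomials,
   alternately from the two halves of the row. *)
pose s i := if odd (n - i) then n - (n - i)./2 else (n - i)./2.
apply: (@sorted_eq _ geq) => [a b c|a b|||].
- by rewrite /geq /=; lia.
- by rewrite /geq /=; lia.
- apply/(sortedP 0) => i; rewrite size_mkseq ltnS => lt_in.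
  rewrite !nth_mkseq ?ltnS ?(ltnW lt_in) // /geq /=.
  have [->//|/eqP ne] := eqVneq (n - i.+1)./2 (n - i)./2.
  have -> : (n - i)./2 = (n - i.+1)./2.+1 by lia.
  by apply: leq_bin_half; lia.
- by apply: sort_sorted => a b; rewrite /geq /=; lia.
rewrite perm_sym perm_sort perm_sym.
have -> : mkseq (fun i => 'C(n, (n - i)./2)) n.+1
        = [seq 'C(n, i) | i <- map s (iota 0 n.+1)].
  rewrite -map_comp; apply/eq_in_map => i; rewrite mem_iota /= => lt_in.
  by rewrite /s; case: ifP => // _; rewrite bin_sub //; lia.
apply: perm_map.
have sz : size (iota 0 n.+1) <= size (map s (iota 0 n.+1)) by rewrite size_map.
have uniq_s : uniq (map s (iota 0 n.+1)).
  rewrite map_inj_in_uniq ?iota_uniq // => i j; rewrite !mem_iota /s /=.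
  by do 2!case: ifP => ?; lia.
apply: uniq_perm; rewrite ?iota_uniq //.
have sub : {subset map s (iota 0 n.+1) <= iota 0 n.+1}.
  move=> y /mapP[i]; rewrite !mem_iota /s /= => lt_in ->; case: ifP; lia.
by case: (uniq_min_size uniq_s sub sz).
Qed.
End Combinatorics.

(** * Adjoining a square-zero element to a subalgebra *)

Section AdjoinSquareZero.
Variables (F : fieldType) (n : nat).
Local Notation A := (sqr_quot F n).
Implicit Types (V U : {vspace A}) (x y h g N a b u v : A).

Lemma dim_coset_inj U y :
  {in U, forall u, u * y = 0 -> u = 0} -> \dim (U * <[y]>) = \dim U.
Proof.
move=> inj; rewrite -limg_amulr limg_dim_eq //; apply/eqP.
rewrite -subv0; apply/subvP => u; rewrite memv_cap memv_ker lfunE /= memv0.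
by case/andP=> Uu /eqP/(inj u Uu)->.
Qed.

Lemma dim_coset_le U y : (\dim (U * <[y]>) <= \dim U)%N.
Proof. by rewrite -limg_amulr -(limg_ker_dim (amulr y) U) leq_addl. Qed.

(** Full doubling of the dimension leaves room neither for a nonzero intersection of [V] with [V *
    <[x]>] nor for a kernel of multiplication by [x] on [V]. *)
Lemma adjoin_free V x : \dim (V + V * <[x]>) = (\dim V).*2 ->
  {in V &, forall u v, u + v * x = 0 -> u = 0 /\ v = 0}.
Proof.
move=> dimW.
have [le_sum eq_sum] := dimv_add_leqif V (V * <[x]>).
have dimx : \dim (V * <[x]>) = \dim V.
  apply/eqP; rewrite eqn_leq dim_coset_le -(leq_add2l (\dim V)) addnn -dimW.
  exact: le_sum.
have cap0 : (V :&: V * <[x]> <= 0)%VS.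
  by rewrite -eq_sum dimW dimx addnn.
move=> u v Vu Vv uvx0.
have vx0 : v * x = 0.
  apply/eqP; rewrite -memv0; apply: (subvP cap0).
  rewrite memv_cap memv_mul ?memv_line // andbT.
  by rewrite -[v * x](addKr u) uvx0 addr0 rpredN.
split; first by rewrite vx0 addr0 in uvx0.
have := limg_ker_dim (amulr x) V.
rewrite limg_amulr dimx => /eqP; rewrite -{2}[\dim V]add0n eqn_add2r dimv_eq0.
move=> /eqP ker0; apply/eqP; rewrite -memv0 -ker0 memv_cap Vv memv_ker lfunE /=.
exact/eqP.
Qed.

Lemma exprD_square_zero x a b k : x ^+ 2 = 0 ->
  (a + b * x) ^+ k.+1 = a ^+ k.+1 + k.+1%:R * a ^+ k * b * x.
Proof.
move=> x2; elim: k => [|k IHk]; first by rewrite !expr1 expr0 mulr1 mul1r.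
rewrite [LHS]exprS {}IHk (exprS a k.+1) (exprS a k) -[k.+2]add1n natrD.
ring: x2.
Qed.

Lemma adjoin_closed V x : x ^+ 2 = 0 -> (V * V <= V)%VS ->
  ((V + V * <[x]>) * (V + V * <[x]>) <= V + V * <[x]>)%VS.
Proof.
move=> x2 /prodvP VV; apply/prodvP=> p q.
case/memv_addP=> u1 Vu1 [_ /memv_cosetP[v1 Vv1 ->] ->].
case/memv_addP=> u2 Vu2 [_ /memv_cosetP[v2 Vv2 ->] ->].
have -> : (u1 + v1 * x) * (u2 + v2 * x) = u1 * u2 + (u1 * v2 + v1 * u2) * x.
  by ring: x2.
by apply: memv_add; rewrite ?memv_mul ?rpredD ?memv_line ?VV.
Qed.

(* With [q := (k.+1 * g)^-1], column elimination turns the image of the power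
   into the direct sum of [V * N^k * (q * N + x)] and [V * N^(k+2) * q]. *)
Lemma dim_coset_adjoin V x h g N k :
  (V * V <= V)%VS -> N \in V -> g \in V -> 1 \in V -> h \in V -> h * g = 1 ->
  x ^+ 2 = 0 -> {in V &, forall u v, u + v * x = 0 -> u = 0 /\ v = 0} ->
  k.+1%:R != 0 :> F ->
  \dim ((V + V * <[x]>) * <[(N + g * x) ^+ k.+1]>)
    = (\dim (V * <[N ^+ k]>) + \dim (V * <[N ^+ k.+2]>))%N.
Proof.
move=> /prodvP VV VN Vg V1 Vh hg x2 free nzk.
have VX i : N ^+ i \in V by elim: i => [|i IHi]; rewrite ?exprS ?VV.
pose q := (k.+1%:R^-1 : F)%:A * h : A.
have Vq : q \in V by rewrite VV // rpredZ.
have qg : q * k.+1%:R * g = 1.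
  have -> : k.+1%:R = (k.+1%:R : F)%:A :> A by rewrite scaler_nat.
  rewrite /q (mulrAC _ h) -[LHS]mulrA hg mulr1 -scalerAl mul1r scalerA mulVf //.
  exact: scale1r.
have V_kg : k.+1%:R * g \in V.
  by rewrite VV ?rpredD // -[k.+1%:R]/(1 *+ k.+1) rpredMn.
have Uq : q \is a GRing.unit.
  by apply/unitrP; exists (k.+1%:R * g); rewrite mulrC mulrA qg.
(* For [u] in [V], the coefficient of [x] in [u * (q * N + x)] is [u] itself. *)
have coset_dim : \dim ((V * <[N ^+ k]>) * <[q * N + x]>)
               = \dim (V * <[N ^+ k]>).
  apply: dim_coset_inj => _ /memv_cosetP[a Va ->] aN0.
  have [|||_ ->] // := free (a * N ^+ k * (q * N)) (a * N ^+ k).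
  - by do ?[by [] | exact: VX | apply: (VV)].
  - by apply: VV (VX k).
  by rewrite -mulrDr.
have -> : ((V + V * <[x]>) * <[(N + g * x) ^+ k.+1]>
   = (V * <[N ^+ k]>) * <[q * N + x]> + (V * <[N ^+ k.+2]>) * <[q]>)%VS.
  (* [c] has to be opaque: [ring] would expand [k.+1%:R] into a sum, and [qg]
     would no longer be a monomial rewrite rule. *)
  rewrite exprD_square_zero //; set c : A := k.+1%:R in qg V_kg *; clearbody c.
  apply: subv_anti; apply/andP; split; apply/subvP => w.
    case/memv_cosetP=> _ /memv_addP[u Vu [_ /memv_cosetP[v Vv ->] ->]] ->.
    (* The coefficient of [x] on the left dictates the multiplier of [q * N + x]; the last term
       corrects the part free of [x]. *)
    have -> : (u + v * x) * (N ^+ k.+1 + c * N ^+ k * g * x) =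
        (c * g * u + N * v) * N ^+ k * (q * N + x)
        + (- v) * N ^+ k.+2 * q.
      by rewrite (exprS N k.+1) (exprS N k); ring: x2 qg.
    apply: memv_add; rewrite !memv_mul ?memv_line ?rpredN //.
    by apply: rpredD; do ?[by [] | apply: (VV)].
  case/memv_addP=> _ /memv_cosetP[_ /memv_cosetP[a Va ->] ->].
  case=> _ /memv_cosetP[_ /memv_cosetP[v Vv ->] ->] ->.
  (* [u := q * (a + N * v)] solves [c * g * u + N * (- v) = a], which inverts the previous
     decomposition. *)
  apply/memv_cosetP; exists ((q * a + q * N * v) + (- v) * x).
    apply: memv_add; last by rewrite memv_mul ?memv_line ?rpredN.
    by apply: rpredD; do ?[by [] | apply: (VV)].
  by rewrite (exprS N k.+1) (exprS N k); ring: x2 qg.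
rewrite dimv_disjoint_sum ?coset_dim ?(dim_cosetv_unit _ Uq) //; apply/eqP.
rewrite -subv0; apply/subvP => w; rewrite memv_cap => /andP[].
case/memv_cosetP=> _ /memv_cosetP[a Va ->] ->.
case/memv_cosetP=> _ /memv_cosetP[v Vv ->] wE.
(* The second summand lies in [V], so the coefficient [a * N ^+ k] of [x] must vanish, and [w] with
   it. *)
have [|||_ ->] // :=
  free (a * N ^+ k * (q * N) - v * N ^+ k.+2 * q) (a * N ^+ k).
- by apply: rpredB; do ?[by [] | exact: VX | apply: (VV)].
- by apply: VV (VX k).
- by rewrite addrAC -mulrDr wE subrr.
by rewrite mul0r mem0v.
Qed.

End AdjoinSquareZero.

(** * The chain of subalgebras and its ranks *)

Section SquareZeroChain.
Variables (F : fieldType) (n : nat).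
Local Notation A := (sqr_quot F n).
Variable x : nat -> A.
Hypothesis x2 : forall i, x i ^+ 2 = 0.

Fixpoint chain (m : nat) : {vspace A} :=
  if m is m'.+1 then (chain m' + chain m' * <[x m']>)%VS else 1%VS.

Definition chain_prod (m : nat) : A := \prod_(i < m) (1 + x i).

Local Notation N m := (chain_prod m - 1).

Lemma chain_prodS m : chain_prod m.+1 = chain_prod m * (1 + x m).
Proof. by rewrite /chain_prod big_ord_recr. Qed.

Lemma chain_nilS m : N m.+1 = N m + chain_prod m * x m.
Proof. by rewrite chain_prodS; ring. Qed.

Lemma mem1_chain m : 1 \in chain m.
Proof.
elim: m => [|m IHm] /=; first exact: memv_line.
by apply: (subvP (addvSl _ _)).
Qed.

Lemma chain_mul m : (chain m * chain m <= chain m)%VS.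
Proof. by elim: m => [|m IHm] /=; [rewrite prod1v | apply: adjoin_closed]. Qed.

Lemma subv_chain l m : (l <= m)%N -> (chain l <= chain m)%VS.
Proof.
elim: m => [|m IHm]; first by rewrite leqn0 => /eqP->.
rewrite leq_eqVlt => /predU1P[->//|/IHm le_lm].
exact: subv_trans le_lm (addvSl _ _).
Qed.

Lemma mem_chain i m : (i < m)%N -> x i \in chain m.
Proof.
move=> lt_im; apply: (subvP (subv_chain lt_im)).
apply: (subvP (addvSr _ _)).
by have := memv_mul (mem1_chain i) (memv_line (x i)); rewrite mul1r.
Qed.

(** Stated for any [y] to cover both [chain_prod m] and its inverse, where [y i = - x i]. *)
Lemma mem_chain_prod (y : nat -> A) m :
  (forall i, (i < m)%N -> y i \in chain m) ->
  \prod_(i < m) (1 + y i) \in chain m.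
Proof.
move=> cy; elim/big_ind: _ => [|u v cu cv|i _]; first exact: mem1_chain.
  by apply: (prodvP (chain_mul m)).
by rewrite rpredD ?mem1_chain ?cy.
Qed.

Lemma chain_prodV m : (\prod_(i < m) (1 - x i)) * chain_prod m = 1.
Proof.
rewrite /chain_prod -big_split big1 //= => i _.
by have xi2 := x2 i; ring: xi2.
Qed.

(** By induction: both terms left in the expansion of [N m.+1 ^+ m.+2] contain [N m ^+ m.+1]. *)
Lemma chain_nil_eq0 m : N m ^+ m.+1 = 0.
Proof.
elim: m => [|m IHm]; first by rewrite /chain_prod big_ord0 subrr expr1.
by rewrite chain_nilS exprD_square_zero // exprS IHm !(mulr0, mul0r) addr0.
Qed.

Lemma chain_nil_big m k : (m < k)%N -> N m ^+ k = 0.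
Proof. by move=> lt_mk; rewrite -(subnK lt_mk) exprD chain_nil_eq0 mulr0. Qed.

Lemma dim_chain_le m d : (\dim (chain (m + d)) <= 2 ^ d * \dim (chain m))%N.
Proof.
elim: d => [|d IHd]; first by rewrite addn0 mul1n.
rewrite addnS /= expnS -mulnA (leq_trans (dimv_add_leqif _ _)) //.
by rewrite mul2n -addnn leq_add // (leq_trans (dim_coset_le _ _)).
Qed.

(* Each step at most doubles the dimension, so knowing only the dimension of
   the last space forces every step to be a free extension. *)
Hypothesis dim_top : \dim (chain n) = (2 ^ n)%N.

Lemma dim_chain m : (m <= n)%N -> \dim (chain m) = (2 ^ m)%N.
Proof.
move=> le_mn; apply/eqP; rewrite eqn_leq; apply/andP; split.
  by have := dim_chain_le 0 m; rewrite add0n /= dimv1 muln1.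
(* At most [n - m] doublings remain to reach [2 ^ n]. *)
have := dim_chain_le m (n - m); rewrite subnKC // dim_top.
by rewrite -{1}(subnK le_mn) expnD leq_pmul2l // expn_gt0.
Qed.

Hypothesis natF : forall k, (0 < k <= n)%N -> k%:R != 0 :> F.

(** The rank r(m, k): [chain m * <[y]>] is the image of [chain m] under multiplication by [y]. *)
Definition chain_rank m k := \dim (chain m * <[N m ^+ k]>).

Lemma chain_rankS m k : (m < n)%N -> (k <= m)%N ->
  chain_rank m.+1 k.+1 = (chain_rank m k + chain_rank m k.+2)%N.
Proof.
move=> lt_mn le_km; rewrite /chain_rank chain_nilS /=.
have cP : chain_prod m \in chain m.
  by apply: mem_chain_prod => i; apply: mem_chain.
apply: dim_coset_adjoin (chain_prodV m) _ _ _ => //.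
- exact: chain_mul.
- by rewrite rpredB ?mem1_chain.
- exact: mem1_chain.
- apply: (mem_chain_prod (y := fun i => - x i)) => i /mem_chain.
  by rewrite rpredN.
- apply: adjoin_free; rewrite -[LHS]/(\dim (chain m.+1)) !dim_chain //.
    by rewrite expnS mul2n.
  exact: ltnW.
by apply: natF; apply: leq_ltn_trans lt_mn.
Qed.

Lemma chain_rank_big m k : (m < k)%N -> chain_rank m k = 0%N.
Proof. by move=> lt_mk; rewrite /chain_rank chain_nil_big // prodv0 dimv0. Qed.

Lemma chain_rankE m k : (m <= n)%N -> (k <= m)%N ->
  chain_rank m k = (chain_rank m k.+1 + 'C(m, (m - k)./2))%N.
Proof.
apply: binomial_of_recurrence chain_rank_big chain_rankS m k => m le_mn.
by rewrite /chain_rank expr0 prodv1 dim_chain.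
Qed.

End SquareZeroChain.

(** * The quotient algebra as the end of the chain *)

Section SquarefreeAlgebra.
Variables (F : fieldType) (n : nat).
Local Notation A := (sqr_quot F n).

(** Indexing by [nat] keeps one type along the chain; the default 0 beyond [n] also squares to
    zero. *)
Definition nat_var (i : nat) : A := oapp (@quot_var F n) 0 (insub i).

Lemma nat_var_ord (i : 'I_n) : nat_var i = quot_var F i.
Proof. by rewrite /nat_var valK. Qed.

Lemma nat_var_sqr i : nat_var i ^+ 2 = 0.
Proof.
rewrite /nat_var; case: insub => [j|] /=; last by rewrite expr0n.
rewrite /quot_var -rmorphXn -(rmorph0 (@sqr_pi F n)); apply/sqr_piP.
rewrite subr0; exists (fun l => (l == j)%:R).
rewrite (bigD1 j) //= eqxx mul1r big1 ?addr0 // => l /negPf->.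
by rewrite mul0r.
Qed.

Lemma chain_prod_quot_g : chain_prod nat_var n = quot_g F n.
Proof. by apply: eq_bigr => i _; rewrite nat_var_ord. Qed.

(** The last space is closed under products and contains 1 and every variable, hence every
    monomial. *)
Lemma chain_full : chain nat_var n = fullv.
Proof.
have /prodvP cM := chain_mul nat_var_sqr n.
have c1 := mem1_chain nat_var n.
apply/vspaceP => y; rewrite memvf; have [p ->] := sqr_pi_surj y.
elim/mpolyind: p => [|c m p _ _ IHp]; first by rewrite rmorph0 mem0v.
rewrite linearP rpredD // rpredZ // mpolyXE_id rmorph_prod /=.
elim/big_ind: _ => // i _; rewrite rmorphXn /=.
elim: (m i) => [|k IHk]; first by rewrite expr0.
rewrite exprS cM // -[sqr_pi _]/(quot_var F i) -nat_var_ord.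
exact: mem_chain (ltn_ord i).
Qed.

Lemma dim_sqr_quot : \dim {:A} = (2 ^ n)%N.
Proof.
rewrite dimvf -[LHS]/#|{set 'I_n}|.
by rewrite -cardsT -powersetT card_powerset cardsT card_ord.
Qed.

Lemma quot_g_nil : (quot_g F n - 1) ^+ n.+1 = 0.
Proof. by rewrite -chain_prod_quot_g chain_nil_eq0 //; apply: nat_var_sqr. Qed.

(** Subtracting the identity from multiplication by g leaves multiplication by g - 1, whose iterates
    are multiplications by powers of g - 1. *)
Lemma eig_rank_quot_g k :
  eig_rank (amull (quot_g F n)) 1 k = chain_rank nat_var n k.
Proof.
have iterE (u : A) : lfun_iter (amull u) k = amull (u ^+ k).
  apply/lfunP => v; rewrite lfunE /= /lfun_iter.
  elim: k => [|l IHl]; first by rewrite id_lfunE expr0 mul1r.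
  by rewrite iterS comp_lfunE IHl lfunE /= exprS mulrA.
have -> : amull (quot_g F n) = amull (quot_g F n - 1) + 1 *: \1%VF.
  by rewrite scale1r linearB /= amull1 subrK.
rewrite /eig_rank addrK iterE /chain_rank chain_prod_quot_g chain_full.
rewrite -limg_amulr; congr (\dim (limg _)).
by apply/lfunP => v; rewrite !lfunE /= mulrC.
Qed.

Lemma leigenvalue_quot_g a :
  passmx.leigenvalue (amull (quot_g F n)) a = (a == 1).
Proof.
have eigP : reflect (exists2 v : A, v != 0 & quot_g F n * v = a *: v)
    (passmx.leigenvalue (amull (quot_g F n)) a).
  have kerE (v : A) : (v \in lker (amull (quot_g F n) - a *: \1%VF))
    = (quot_g F n * v == a *: v).
    by rewrite memv_ker add_lfunE opp_lfunE scale_lfunE id_lfunE lfunE subr_eq0.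
  apply: (iffP idP) => [nz|[v nzv gv]].
    exists (vpick (passmx.leigenspace (amull (quot_g F n)) a)).
      by rewrite vpick0.
    by apply/eqP; rewrite -kerE memv_pick.
  apply: contraNneq nzv => ker0; rewrite -memv0 -ker0.
  by rewrite /passmx.leigenspace kerE gv.
apply/eigP/eqP => [[v nzv gv]|->].
  (* g - 1 acts on an eigenvector as [a - 1], so its nilpotency forces [a = 1]. *)
  have powE k : (quot_g F n - 1) ^+ k * v = (a - 1) ^+ k *: v.
    elim: k => [|k IHk]; first by rewrite !expr0 mul1r scale1r.
    rewrite exprS -mulrA IHk -scalerAr mulrBl mul1r gv -{2}[v]scale1r -scalerBl.
    by rewrite scalerA -exprSr.
  apply/eqP; have /eqP := powE n.+1; rewrite quot_g_nil mul0r eq_sym scaler_eq0.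
  by rewrite (negPf nzv) orbF expf_eq0 /= subr_eq0.
(* The last nonzero power of g - 1 is an eigenvector for 1. *)
have ex : exists k, (quot_g F n - 1) ^+ k.+1 == 0.
  by exists n; rewrite quot_g_nil.
case: (ex_minnP ex) => k /eqP nil_k min_k.
exists ((quot_g F n - 1) ^+ k).
  case: k => [|k] in nil_k min_k *; first by rewrite expr0 oner_eq0.
  by apply/negP => /min_k; rewrite ltnn.
by apply/eqP; rewrite scale1r -subr_eq0 -{2}[_ ^+ k]mul1r -mulrBl -exprS nil_k.
Qed.

End SquarefreeAlgebra.

Lemma natr_neq0_leq (F : fieldType) (n k : nat) :
  [pchar F] =i pred0 \/ (exists2 p, p \in [pchar F] & (n < p)%N) ->
  (0 < k <= n)%N -> k%:R != 0 :> F.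
Proof.
case=> [/pcharf0P-> | [p pF lt_np]] /andP[k0 le_kn]; first by rewrite -lt0n.
by rewrite -(dvdn_pcharf pF) gtnNdvd // (leq_ltn_trans le_kn).
Qed.

Theorem theorem6p1 (F : fieldType) (n : nat)
    (hF : [pchar F] =i pred0 \/ exists2 p : nat, p \in [pchar F] & (n < p)%N) :
  let T := amull (quot_g F n) in
  (forall a : F, passmx.leigenvalue T a = (a == 1)) /\
  weyr_structure T 1 = sort geq [seq 'C(n, i) | i <- iota 0 n.+1].
Proof.
move=> T; split; first exact: leigenvalue_quot_g.
have rankE k : (k <= n)%N ->
    eig_rank T 1 k = (eig_rank T 1 k.+1 + 'C(n, (n - k)./2))%N.
  rewrite !eig_rank_quot_g => le_kn.
  apply: chain_rankE => //; first exact: nat_var_sqr.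
    by rewrite chain_full dim_sqr_quot.
  by move=> j; apply: natr_neq0_leq.
have rank0 k : (n < k)%N -> eig_rank T 1 k = 0%N.
  by rewrite eig_rank_quot_g; apply: chain_rank_big; apply: nat_var_sqr.
(* For [k <= n] the rank drops by a positive binomial coefficient; from [n.+1] on it is 0. *)
have index : weyr_index T 1 = n.+1.
  rewrite /weyr_index; case: ex_minnP => r /andP[_ eq_r] min_r.
  apply/eqP; rewrite eqn_leq min_r ?rank0 //= ltnNge.
  apply/negP => /rankE/eqP; rewrite (eqP eq_r) -{1}[eig_rank _ _ _]addn0.
  by rewrite eqn_add2l eq_sym -leqn0 leqNgt bin_gt0; lia.
rewrite /weyr_structure index -sort_binomials; apply/eq_in_map => i.
by rewrite mem_iota ltnS => le_in; rewrite rankE // addKn.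
Qed.
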